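(* Let $H$ be a finite digraph. If $H$ contains a symmetrically invertible pair, then $H$ does not admit a Min-Max ordering.
   Context: A linear ordering $<$ of $V(H)$ is a Min-Max ordering if for all vertices $i,j,s,r$: $i<j$, $s<r$ and $ir, js \in A(H)$ imply $is,jr \in A(H)$. A walk $x_0,\dots,x_n$ is a sequence of vertices where each $x_ix_{i+1}$ is either a forward arc ($x_ix_{i+1}\in A(H)$) or a backward arc ($x_{i+1}x_i\in A(H)$), with a designated choice. Walks $P=x_0,\dots,x_n$, $Q=y_0,\dots,y_n$ are congruent if $x_ix_{i+1}$ is forward iff $y_iy_{i+1}$ is forward, for all $i$. For congruent $P,Q$, $x_iy_{i+1}$ is a faithful arc from $P$ to $Q$ if it is a forward (resp. backward) arc when $x_ix_{i+1}$ is forward (resp. backward), and $y_ix_{i+1}$ is a faithful arc from $Q$ to $P$ if it is forward (resp. backward) when $x_ix_{i+1}$ is forward (resp. backward). $P,Q$ avoid each other if for no $i\in\{0,\dots,n-1\}$ are both $x_iy_{i+1}$ and $y_ix_{i+1}$ faithful arcs. A symmetrically invertible pair is a pair of distinct vertices $u,v$ with congruent walks $P$ from $u$ to $v$ and $Q$ from $v$ to $u$ that avoid each other. *)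

(* Defs.v *)
From mathcomp Require Import all_boot.

Set Implicit Arguments.
Unset Strict Implicit.
Unset Printing Implicit Defensive.

(* A finite digraph H is a finite vertex type V together with
   its arc relation A : rel V; loops and antiparallel arcs are allowed. *)

Definition strict_linear_order (V : finType) (lt : rel V) : Prop :=
  [/\ irreflexive lt, transitive lt & forall x y, x != y -> lt x y || lt y x].

Definition min_max (V : finType) (A lt : rel V) : Prop :=
  forall i j s r, lt i j -> lt s r -> A i r -> A j s -> A i s /\ A j r.

Definition admits_min_max_ordering (V : finType) (A : rel V) : Prop :=
  exists lt : rel V, strict_linear_order lt /\ min_max A lt.

(* dir_arc A d x y : xy is a forward arc when d = true (x -> y in H), and a
   backward arc when d = false (y -> x in H). *)
Definition dir_arc (V : finType) (A : rel V) (d : bool) (x y : V) : bool :=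
  if d then A x y else A y x.

Definition src n (i : 'I_n) : 'I_n.+1 := widen_ord (leqnSn n) i.
Definition tgt n (i : 'I_n) : 'I_n.+1 := lift ord0 i.

(* A walk x_0, ..., x_n.  The component fwd records, for each step, which
   kind of arc x_i x_{i+1} is designated to be; this is extra data, since both
   x_i -> x_{i+1} and x_{i+1} -> x_i may be arcs of H. *)
Record walk (V : finType) (A : rel V) (n : nat) := Walk {
  vtx : 'I_n.+1 -> V;
  fwd : 'I_n -> bool;
  walk_arc : forall i : 'I_n, dir_arc A (fwd i) (vtx (src i)) (vtx (tgt i))
}.

Definition walk_from_to (V : finType) (A : rel V) (n : nat) (P : walk A n)
    (u v : V) : Prop :=
  vtx P ord0 = u /\ vtx P ord_max = v.

Definition congruent (V : finType) (A : rel V) (n : nat) (P Q : walk A n)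
  : Prop := forall i : 'I_n, fwd P i = fwd Q i.

(* faithful_arc P Q i : x_i y_{i+1} is a faithful arc from P = x_0, ..., x_n to
   Q = y_0, ..., y_n.  Only used for congruent P and Q, so the direction
   of step i may be read off from either walk. *)
Definition faithful_arc (V : finType) (A : rel V) (n : nat) (P Q : walk A n)
    (i : 'I_n) : bool :=
  dir_arc A (fwd P i) (vtx P (src i)) (vtx Q (tgt i)).

Definition avoid_each_other (V : finType) (A : rel V) (n : nat)
    (P Q : walk A n) : Prop :=
  forall i : 'I_n, ~ (faithful_arc P Q i /\ faithful_arc Q P i).

Definition symmetrically_invertible_pair (V : finType) (A : rel V) (u v : V)
  : Prop :=
  u <> v /\
  exists (n : nat) (P Q : walk A n),
    [/\ walk_from_to P u v, walk_from_to Q v u,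
        congruent P Q & avoid_each_other P Q].

(* Main.v *)
Require Import Defs.
From mathcomp Require Import all_boot.

(** Along two congruent walks avoiding each other, the order of corresponding
    vertices never changes: a swap or a collision at step [i] would yield both
    faithful arcs at [i], by the Min-Max property or trivially. Walks from [u]
    to [v] and from [v] to [u] would reverse the order of [u] and [v]. *)

(** The Min-Max condition is invariant under reversing all arcs: for [d = false] it applies with
    [y'], [x'] as tails and [x], [y] as heads. *)
Lemma min_max_dir_arc (V : finType) (A lt : rel V) (d : bool) (x y x' y' : V) :
  min_max A lt -> lt x y -> lt y' x' -> dir_arc A d x x' -> dir_arc A d y y' ->
  dir_arc A d x y' /\ dir_arc A d y x'.
Proof.
move=> mm ltxy lty'x'; case: d => /= Axx' Ayy'; first exact: mm Axx' Ayy'.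
by have [] := mm _ _ _ _ lty'x' ltxy Ayy' Axx'.
Qed.

Lemma avoid_each_other_sym (V : finType) (A : rel V) n (P Q : walk A n) :
  avoid_each_other P Q -> avoid_each_other Q P.
Proof. by move=> av i [fQP fPQ]; apply: (av i). Qed.

Lemma avoid_lt_step (V : finType) (A lt : rel V) n (P Q : walk A n) (i : 'I_n) :
  strict_linear_order lt -> min_max A lt ->
  congruent P Q -> avoid_each_other P Q ->
  lt (vtx P (src i)) (vtx Q (src i)) -> lt (vtx P (tgt i)) (vtx Q (tgt i)).
Proof.
case=> _ _ tot mm cong av ltPQ; apply/idPn => nltPQ; apply: (av i).
have aP := walk_arc P i; have aQ := walk_arc Q i.
rewrite /faithful_arc -(cong i) in aQ *.
have [eqPQ | /tot] := eqVneq (vtx P (tgt i)) (vtx Q (tgt i)).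
  (* When the targets coincide, the faithful arcs are the walks' own arcs. *)
  by rewrite -{1}eqPQ {2}eqPQ.
by rewrite (negPf nltPQ) /= => ltQP; apply: min_max_dir_arc mm ltPQ ltQP aP aQ.
Qed.

Lemma avoid_lt_end (V : finType) (A lt : rel V) n (P Q : walk A n) :
  strict_linear_order lt -> min_max A lt ->
  congruent P Q -> avoid_each_other P Q ->
  lt (vtx P ord0) (vtx Q ord0) -> lt (vtx P ord_max) (vtx Q ord_max).
Proof.
move=> slo mm cong av lt0.
suff lt_all k (ltkn : k < n.+1) :
  lt (vtx P (Ordinal ltkn)) (vtx Q (Ordinal ltkn)) by exact: lt_all.
elim: k ltkn => [|k IHk] ltkn.
  by rewrite (_ : Ordinal ltkn = ord0) //; apply: val_inj.
(* Vertex [k.+1] is the target of step [k]; its bound [k.+1 < n.+1] is convertible to [k < n]. *)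
pose i : 'I_n := Ordinal (ltkn : k < n).
rewrite (_ : Ordinal ltkn = tgt i); last exact: val_inj.
by apply: avoid_lt_step => //; apply: IHk.
Qed.

Theorem theorem2 (V : finType) (A : rel V) :
  (exists u v : V, symmetrically_invertible_pair A u v) ->
  ~ admits_min_max_ordering A.
Proof.
case=> u [v [/eqP neq_uv [n [P [Q [[P0 Pn] [Q0 Qn] cong av]]]]]] [lt [slo mm]].
have [irr tr tot] := slo.
have asym x y : lt x y -> ~~ lt y x.
  by move=> ltxy; apply/negP => /(tr _ _ _ ltxy); rewrite irr.
have [ltuv | ltvu] := orP (tot _ _ neq_uv).
  have := avoid_lt_end _ _ _ _ _ _ slo mm cong av.
  by rewrite P0 Q0 Pn Qn => /(_ ltuv); apply/negP/asym.
(* If [v] precedes [u], the same argument runs with [P] and [Q] exchanged. *)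
have := avoid_lt_end _ _ _ _ _ _ slo mm (fun i => esym (cong i))
                    (avoid_each_other_sym _ _ _ _ _ av).
by rewrite P0 Q0 Pn Qn => /(_ ltvu); apply/negP/asym.
Qed.
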